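(* Let $q$ be an odd prime power, $t\ge3$ an integer, $\sigma=q^J$ with $J\in\{1,\ldots,2t-1\}$ and $\gcd(J,2t)=1$, $m\in\mathbb{F}_{q^t}^*$, and $$\phi_{m,\sigma}=X^{\sigma^{t-1}}+X^{\sigma^{2t-1}}+m\left(X^\sigma-X^{\sigma^{t+1}}\right)\in\mathbb{F}_{q^{2t}}[X].$$ Let $E=\ker\mathrm{Tr}_{q^{2t}/q^t}$. - If $m$ is a $(\sigma-1)$-power of an element of $E$, then $L_{\phi_{m,\sigma}}$ is an $(r,2)$-regular fat linear set for some integer $r$. - If $m$ is a $(\sigma+1)$-power of an element of $E$ and $t$ is odd, then $L_{\phi_{m,\sigma}}$ is a $(2,t)$-regular fat linear set. - If $m$ is a $(\sigma+1)$-power of an element of $E$ and $t$ is even, then $L_{\phi_{m,\sigma}}$ is a $(q+1,t)$-regular fat linear set. - Otherwise, $L_{\phi_{m,\sigma}}$ is a scattered linear set.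
   Context: $\mathrm{Tr}_{q^{2t}/q^t}(x)=x^{q^t}+x$, so $E=\{x\in\mathbb{F}_{q^{2t}}\colon x^{q^t}+x=0\}$. For an $\mathbb{F}_q$-linearized polynomial $f$ over $\mathbb{F}_{q^{2t}}$ let $U_f=\{(x,f(x))\colon x\in\mathbb{F}_{q^{2t}}\}$ and $L_f=\{\langle(x,f(x))\rangle_{\mathbb{F}_{q^{2t}}}\colon x\in\mathbb{F}_{q^{2t}}^*\}\subseteq\mathrm{PG}(1,q^{2t})$. (As a map on $\mathbb{F}_{q^{2t}}$, $X^{q^j}$ depends only on $j$ modulo $2t$.) The weight of a point $P=\langle v\rangle_{\mathbb{F}_{q^{2t}}}$ is $\dim_{\mathbb{F}_q}(\langle v\rangle_{\mathbb{F}_{q^{2t}}}\cap U_f)$. For integers $r\ge0$, $i\ge2$, $L_f$ is $(r,i)$-regular fat if it has exactly $r$ points of weight $i$, all its remaining points have weight one, and there is at least one point of weight one. $L_f$ is scattered if all its points have weight one. *)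

(* Defs.v *)
From HB Require Import structures.
From mathcomp Require Import all_boot all_order all_algebra all_field.

Set Implicit Arguments.
Unset Strict Implicit.
Unset Printing Implicit Defensive.

Import GRing.Theory.
Local Open Scope ring_scope.

Section LinearSets.

(* F plays the role of F_q, so that q = #|F|, and L that of its extension
   F_(q^n), where n = \dim {:L}. *)
Variables (F : finFieldType) (L : fieldExtType F).
Implicit Types (f : {poly L}) (P : {vspace (L * L)}) (v : L * L).

Definition linearized f : Prop :=
  forall k, f`_k != 0 -> exists i, k = (#|F| ^ i)%N.

(* linfun yields a meaningful result only if its argument is F-linear: this is
   the case here when f is linearized, see memv_graph. *)
Definition graph f : {vspace (L * L)} := limg (linfun (fun x : L => (x, f.[x]))).

(* The point <v>_L, as an F-subspace of L * L; see memv_point. *)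
Definition point v : {vspace (L * L)} :=
  limg (linfun (fun a : L => (a * v.1, a * v.2))).

(* The linear set L_f, as a duplicate-free sequence of points; finvect_type L
   is L itself, with its structure of finite type. *)
Definition linear_set f : seq {vspace (L * L)} :=
  undup [seq point (x, f.[x]) | x <- enum (finvect_type L) & (x : L) != 0].

Definition weight f P : nat := \dim (P :&: graph f).

Definition regular_fat (r i : nat) f : Prop :=
  [/\ (2 <= i)%N,
      count (fun P => weight f P == i) (linear_set f) = r,
      {in linear_set f, forall P, weight f P != i -> weight f P = 1%N}
    & exists2 P, P \in linear_set f & weight f P = 1%N].

Definition scattered f : Prop :=
  {in linear_set f, forall P, weight f P = 1%N}.

(* The trace of F_(q^(2t)) over F_(q^t). *)
Definition rel_trace (t : nat) (x : L) : L := x ^+ (#|F| ^ t) + x.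

Definition rel_trace_ker (t : nat) : {pred L} :=
  [pred x : L | rel_trace t x == 0].

Definition is_power_of (A : {pred L}) (k : nat) (m : L) : Prop :=
  exists2 e, e \in A & m = e ^+ k.

Definition phi (t : nat) (m : L) (sigma : nat) : {poly L} :=
  'X^(sigma ^ (t - 1)) + 'X^(sigma ^ (2 * t - 1))
    + m *: ('X^sigma - 'X^(sigma ^ (t + 1))).

Lemma expf_card_scale (c : F) (x : L) i :
  (c *: x) ^+ (#|F| ^ i) = c *: x ^+ (#|F| ^ i).
Proof.
rewrite exprZn; congr (_ *: _).
elim: i => [|i IHi]; first by rewrite expn0 expr1.
by rewrite expnS exprM expf_card.
Qed.

Lemma expf_card_add (x y : L) i :
  (x + y) ^+ (#|F| ^ i) = x ^+ (#|F| ^ i) + y ^+ (#|F| ^ i).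
Proof.
have [p _ pF] := finPcharP F; rewrite (card_pprimeChar pF) -expnM.
have pL : p \in [pchar L] by rewrite (pchar_lalg L).
elim: (_ * i)%N => // n IHn.
by rewrite expnSr !exprM {}IHn -(pFrobenius_autE pL) rmorphD.
Qed.

Lemma linearized_linear f : linearized f -> linear (fun x : L => f.[x]).
Proof.
move=> lin_f c x y; rewrite !horner_coef scaler_sumr -big_split /=.
apply: eq_bigr => k _.
have [->|/lin_f[i ->]] := eqVneq f`_k 0; first by rewrite !mul0r scaler0 addr0.
by rewrite expf_card_add expf_card_scale mulrDr scalerAr.
Qed.

Lemma memv_limg_linear (g : L -> L * L) v :
  linear g -> reflect (exists x, v = g x) (v \in limg (linfun g)).
Proof.
move=> lin_g; pose h := GRing.isLinear.Build F L (L * L)%type *:%R g lin_g.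
pose gL : {linear L -> (L * L)%type} := HB.pack g h.
by apply: (iffP memv_imgP) => [[x _ ->]|[x ->]]; exists x;
  rewrite ?memvf // (lfunE gL).
Qed.

Lemma memv_graph f v :
  linearized f -> reflect (exists x, v = (x, f.[x])) (v \in graph f).
Proof.
move=> /linearized_linear lin_f; apply: memv_limg_linear => c x y.
by rewrite lin_f.
Qed.

Lemma memv_point v u :
  reflect (exists a, u = (a * v.1, a * v.2)) (u \in point v).
Proof.
apply: memv_limg_linear => c x y.
by rewrite !mulrDl -!scalerAl.
Qed.

Lemma mem_linear_set f P :
  reflect (exists2 x, x != 0 & P = point (x, f.[x])) (P \in linear_set f).
Proof.
rewrite mem_undup; apply: (iffP mapP) => [[x]|[x x0 ->]].
  by rewrite mem_filter => /andP[x0 _] ->; exists x.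
exists x; rewrite // mem_filter x0 /=.
exact: (mem_enum predT (x : finvect_type L)).
Qed.

Lemma phi_linearized t m J : linearized (phi t m (#|F| ^ J)).
Proof.
move=> k; rewrite /phi !(coefD, coefZ, coefN, coefXn) -!expnM.
case: (k =P _) => [-> _|_]; first by exists (J * (t - 1))%N.
case: (k =P _) => [-> _|_]; first by exists (J * (2 * t - 1))%N.
case: (k =P _) => [-> _|_]; first by exists J.
case: (k =P _) => [-> _|_]; first by exists (J * (t + 1))%N.
by rewrite subrr mulr0 !addr0 eqxx.
Qed.

End LinearSets.

(* Main.v *)
From HB Require Import structures.
Require Import Defs.
From mathcomp Require Import all_boot all_order all_algebra all_field.
From mathcomp Require Import ring zify.

(** Write s for x |-> x^sigma, bar for x |-> x^(q^t), K = F_(q^t), and recall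
    that s generates Gal(L / F_q), so that bar = s^t and the fixed field of s is
    F_q. As q is odd, L is the direct sum of K and E, the eigenspaces of bar for
    1 and -1, and both are stable under s. Writing 2 x = s a + b with a in K and
    b in E, the quadrinomial becomes f(x) = a + m s(b).

    The weight of the point of x is the F_q-dimension of the fibre of x, the
    space of the y with y f(x) = f(y) x. Let (a', b') be the parts of y, and
    put D = a b' - a' b, an element of E. Splitting the equation of the fibre
    along K and E gives [split_collinear]
      m s(D) = D    and    a s(a') - a' s(a) = m (b s(b') - b' s(b)).

    If D != 0, the first equation exhibits m as the (sigma - 1)-power of 1/D.
    If D = 0, then (a', b') = h (a, b) for some h in K, and the second equation
    says (s h - h) (a s(a) - m b s(b)) = 0. So either y is in the F_q-line of x,
    or x is degenerate, a s(a) = m b s(b), which means that r = a / b, in E,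
    satisfies r s(r) = m; then f(x) = 2 r x and h may be any element of K.

    If m is not a (sigma - 1)-power, D always vanishes: degenerate points have
    weight t, all others have weight 1, and degenerate points correspond to the
    r in E with r s(r) = m. The quotients of two such r are the z in K with
    z s(z) = 1, of which there are 2 if t is odd and q + 1 if t is even
    [unit_norm_seq].

    Comparing products over the powers of s shows that m cannot be a
    (sigma - 1)-power and a (sigma + 1)-power of elements of E at the same time
    [powers_exclusive].

    Finally let m be a (sigma - 1)-power, so that m s(w) = w for some nonzero w
    in E. No point is degenerate, y |-> D maps the fibre of x to the line
    F_q w with kernel F_q x, and weights are at most 2. What is left is to find
    a point of weight 1 [exists_fiber_line]. If x has parts A and (u / A) w,
    where A and u are in K, then having weight 2 forces the element
    d (u - s u) / (1 - d u s(u)), where d = (w / (A s(A)))^2, to have the form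
    s(h) - h, so its trace over F_q vanishes. Clearing denominators turns this
    trace into a polynomial in u of degree less than q^t, whose coefficient of
    degree 1 is nonzero as soon as s(d) != d; so it does not vanish on all of
    K [exists_trace_fraction_neq0]. An A with s(d) != d exists because
    K is larger than F_(q^2) [exists_unstable_multiplier]. *)

Set Implicit Arguments.
Unset Strict Implicit.
Unset Printing Implicit Defensive.

Import GRing.Theory.
Local Open Scope ring_scope.

(** * The Frobenius maps *)

Section Frobenius.

Variables (F : finFieldType) (L : fieldExtType F).
Implicit Types (x y : L) (K : {subfield L}).

Definition frob (i : nat) (x : L) : L := x ^+ (#|F| ^ i).

Fact frob_is_zmod_morphism i : zmod_morphism (frob i).
Proof.
move=> x y; rewrite /frob -scaleN1r expf_card_add expf_card_scale.
by rewrite scaleN1r.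
Qed.
HB.instance Definition _ i :=
  GRing.isZmodMorphism.Build L L (frob i) (frob_is_zmod_morphism i).

Fact frob_is_monoid_morphism i : monoid_morphism (frob i).
Proof. by split=> [|x y]; rewrite /frob ?expr1n ?exprMn. Qed.
HB.instance Definition _ i :=
  GRing.isMonoidMorphism.Build L L (frob i) (frob_is_monoid_morphism i).

Fact frob_is_scalable i : scalable (frob i).
Proof. by move=> c x; rewrite /frob expf_card_scale. Qed.
HB.instance Definition _ i :=
  GRing.isScalable.Build F L L *:%R (frob i) (frob_is_scalable i).

Lemma frob0 x : frob 0 x = x.
Proof. exact: expr1. Qed.

Lemma frob_frob i j x : frob i (frob j x) = frob (i + j) x.
Proof. by rewrite /frob -exprM mulnC -expnD. Qed.

Lemma frobC i j x : frob i (frob j x) = frob j (frob i x).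
Proof. by rewrite !frob_frob addnC. Qed.

Lemma mem_subfield_frob K x : (x \in K) = (frob (\dim K) x == x).
Proof. exact: Fermat's_little_theorem. Qed.

Lemma frob_dimf x : frob (\dim {:L}) x = x.
Proof. by apply/eqP; rewrite -mem_subfield_frob memvf. Qed.

Lemma frob_fixM i k x : frob i x = x -> frob (k * i) x = x.
Proof.
by move=> fx; elim: k => [|k IHk]; rewrite ?frob0 // mulSn -frob_frob IHk.
Qed.

Lemma frob_fix_mod n i j x :
  frob n x = x -> i = j %[mod n] -> frob i x = frob j x.
Proof.
move=> fx eqij; rewrite (divn_eq i n) (divn_eq j n) eqij.
by rewrite ![(_ * n + _)%N]addnC -!frob_frob !frob_fixM.
Qed.

Lemma modular_inverse J n :
  (0 < J)%N -> coprime J n -> exists k, k * J = 1 %[mod n].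
Proof.
move=> J0 cJn; exists (chinese J n 0 1 %/ J)%N; rewrite divnK.
  by rewrite chinese_modr.
by rewrite /dvdn chinese_modl // mod0n.
Qed.

(** The powers J and n of the Frobenius generate its first power. *)
Lemma frob_fix1 J n x :
  (0 < J)%N -> coprime J n -> frob J x = x -> frob n x = x -> frob 1 x = x.
Proof.
move=> J0 /(modular_inverse J0)[k kJ] fJ fn.
by rewrite -(frob_fix_mod fn kJ) frob_fixM.
Qed.

Lemma frob1_scalar x : frob 1 x = x -> exists c : F, x = c%:A.
Proof.
move=> fx; have: x \in 1%AS by rewrite mem_subfield_frob dimv1 fx.
by case/vlineP=> c ->; exists c.
Qed.

(** Fixed points of x |-> x^(q^i) are roots of 'X^(q^i) - 'X. *)
Lemma card_fixed_frob (rs : seq L) i :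
  uniq rs -> (0 < i)%N -> {in rs, forall x, frob i x = x} ->
  (size rs <= #|F| ^ i)%N.
Proof.
move=> Urs i0 fix_rs; have F1 := finNzRing_gt1 F.
have q1: (1 < #|F| ^ i)%N by rewrite -(exp1n i) ltn_exp2r.
have sz: size ('X^(#|F| ^ i) - 'X : {poly L}) = (#|F| ^ i).+1.
  by rewrite size_polyDl size_polyXn // size_polyN size_polyX.
rewrite -ltnS -sz; apply: max_poly_roots => //.
  by rewrite -size_poly_eq0 sz.
apply/allP=> x /fix_rs fx.
by rewrite rootE !hornerE subr_eq0 -/(frob i x) fx.
Qed.

Lemma subfield_elements K :
  exists2 rs : seq L, uniq rs & size rs = (#|F| ^ \dim K)%N /\ rs =i K.
Proof.
pose K' : {vspace finvect_type L} := K.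
have mem_K (x : finvect_type L) : (x \in enum K') = (x \in K).
  by rewrite mem_enum.
have card_K : size (enum K') = (#|F| ^ \dim K)%N by rewrite -cardE card_vspace.
exists (enum K' : seq (finvect_type L)); first exact: enum_uniq.
by split=> [|x]; [exact: card_K | exact: mem_K].
Qed.

End Frobenius.

(** * Nonvanishing of a trace *)

Section Poly.
Variable (R : fieldType).

Lemma deriv_Xn_at0 n : ('X^n : {poly R})^`().[0] = (n == 1)%:R.
Proof.
rewrite derivXn hornerMn hornerXn.
by case: n => [|[|n]] //=; rewrite expr0n mul0rn.
Qed.

Lemma size_prod_le (I : finType) (P : pred I) (p : I -> {poly R})
    (d : I -> nat) :
  (forall i, (size (p i) <= (d i).+1)%N) ->
  (size (\prod_(i | P i) p i)%R <= (\sum_(i | P i) d i).+1)%N.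
Proof.
move=> le_pd.
apply: (big_ind2 (fun (q : {poly R}) e => (size q <= e.+1)%N)) => //.
  by rewrite size_polyC leq_b1.
move=> q1 e1 q2 e2 le1 le2; apply: leq_trans (size_polyMleq _ _) _.
by rewrite -ltnS; case: (size q1 + size q2)%N (leq_add le1 le2) => //= k;
  rewrite addSn addnS !ltnS.
Qed.

End Poly.

Section TraceOfFraction.

Variables (F : finFieldType) (L : fieldExtType F) (K : {subfield L}).
Variable (n J : nat).
Hypothesis (dimK : \dim K = n.+1).

Lemma frob_on_subfield (x : L) : x \in K -> frob n.+1 x = x.
Proof. by rewrite mem_subfield_frob dimK => /eqP. Qed.

(** (q^(n+1) - 1) / (q - 1) is at most half of q^(n+1) - 1. *)
Lemma double_sum_geom_lt : (2 < #|F|)%N ->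
  (\sum_(k < n.+1) #|F| ^ k + \sum_(k < n.+1) #|F| ^ k < #|F| ^ n.+1)%N.
Proof.
move=> q2; have q0 : (0 < #|F|)%N by apply: ltn_trans q2.
rewrite addnn -mul2n -(ltn_predK (_ : 0 < #|F| ^ n.+1)%N) ?expn_gt0 ?q0 //.
rewrite ltnS predn_exp leq_mul2r; apply/orP; right.
by rewrite -ltnS (ltn_predK q2).
Qed.

(** On K, the trace over F_q of D (u - s u) / (1 - D u s(u)), with its
    denominators cleared, is a polynomial Q in u. Once the exponents of q have
    been reduced modulo n + 1 = [K : F_q], every u^(q^k) occurs with degree at
    most 2 in each monomial of Q, so that Q has degree at most twice
    1 + q + ... + q^n, less than the order of K. But Q is not 0, because its
    derivative at 0 is D - s^-1 D. *)
Lemma exists_trace_fraction_neq0 (D : L) :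
  (2 < #|F|)%N -> D \in K -> frob J D != D ->
  (forall u, u \in K -> 1 - D * (u * frob J u) != 0) ->
  exists2 u, u \in K &
    \sum_(k < n.+1) frob k (D * (u - frob J u) / (1 - D * (u * frob J u))) != 0.
Proof.
move=> q2 DK sD den_neq0.
have [rs Urs [sz_rs rsK]] := subfield_elements K; rewrite dimK in sz_rs.
have [/hasP[u] | /hasPn allz] := boolP (has (fun u =>
  \sum_(k < n.+1) frob k (D * (u - frob J u) / (1 - D * (u * frob J u))) != 0)
    rs).
  by rewrite rsK => uK nz; exists u.
(* frob J acts on K as frob j0 does. *)
pose j0 : 'I_n.+1 := inord (J %% n.+1).
have j0E : j0 = J %[mod n.+1] by rewrite inordK ?ltn_pmod // modn_mod.
pose e (k : 'I_n.+1) : nat := (#|F| ^ k)%N.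
pose num k : {poly L} := frob (k : 'I_n.+1) D *: ('X^(e k) - 'X^(e (k + j0))).
pose den k : {poly L} :=
  1 - frob (k : 'I_n.+1) D *: ('X^(e k) * 'X^(e (k + j0))).
pose Q := \sum_k num k * \prod_(j | j != k) den j.
have e_gt0 k : (0 < e k)%N by rewrite expn_gt0 (ltn_trans _ q2).
have e_eq1 k : (e k == 1%N) = (k == 0).
  by rewrite /e -(expn0 #|F|) eqn_exp2l // (ltn_trans _ q2).
have frob_shift u (k : 'I_n.+1) : u \in K ->
    frob (k + j0)%R u = frob k (frob J u).
  move=> uK; rewrite frob_frob; apply: frob_fix_mod (frob_on_subfield uK) _.
  by rewrite /= modn_mod -modnDmr j0E modnDmr.
have numE u k : u \in K -> (num k).[u] = frob k (D * (u - frob J u)).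
  by move=> uK; rewrite !hornerE /e -!/(frob _ u) frob_shift // rmorphM rmorphB.
have denE u k : u \in K -> (den k).[u] = frob k (1 - D * (u * frob J u)).
  move=> uK; rewrite !hornerE /e -!/(frob _ u) frob_shift //.
  by rewrite rmorphB rmorph1 !rmorphM.
have Q_root u : u \in rs -> root Q u.
  move=> u_rs; have uK : u \in K by rewrite -rsK.
  have -> : root Q u = (Q.[u] == 0) by [].
  suff -> : Q.[u] = (\prod_j (den j).[u]) *
     \sum_(k < n.+1) frob k (D * (u - frob J u) / (1 - D * (u * frob J u))).
    by have /negPn/eqP-> := allz u u_rs; rewrite mulr0.
  rewrite horner_sum mulr_sumr; apply: eq_bigr => k _.
  rewrite hornerM numE // horner_prod [in RHS](bigD1 k) //= denE //.
  rewrite [frob k (_ / _)]fmorph_div -![GRing.RMorphism.sort _ _]/(frob k _).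
  have: frob k (1 - D * (u * frob J u)) != 0 by rewrite fmorph_eq0 den_neq0.
  by move: (frob k (1 - _)) (frob k (D * _)) => a b a0; field.
have Q_neq0 : Q != 0.
  apply: contra_neq sD => Q0; suff: Q^`().[0] = D - frob (- j0)%R D.
    rewrite Q0 deriv0 horner0 => /esym/eqP; rewrite subr_eq0 => /eqP eqD.
    rewrite -(frob_fix_mod (frob_on_subfield DK) j0E) eqD frob_frob.
    rewrite -eqD; apply: etrans (frob0 D).
    apply: frob_fix_mod (frob_on_subfield DK) _.
    by have /(congr1 val) := addrN j0; rewrite /= => ->; rewrite mod0n.
  have den0 k : (den k).[0] = 1.
    rewrite /den -exprD hornerD hornerN hornerC hornerZ hornerXn expr0n.
    by rewrite addn_eq0 gtn_eqF //= mulr0 subr0.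
  have num0 k : (num k).[0] = 0.
    rewrite hornerZ hornerD hornerN !hornerXn !expr0n !gtn_eqF //.
    by rewrite subrr mulr0.
  rewrite (raddf_sum (@deriv _)) /= horner_sum.
  under eq_bigr => k _.
    rewrite derivM hornerD !hornerM num0 mul0r addr0 horner_prod.
    rewrite big1 => [|j _]; last exact: den0.
    rewrite mulr1 derivZ derivB hornerZ hornerD hornerN !deriv_Xn_at0 !e_eq1.
    rewrite addr_eq0 mulrBr.
    over.
  rewrite sumrB (bigD1 0) //= mulr1 frob0 big1 ?addr0; last first.
    by move=> k /negPf->; rewrite mulr0.
  rewrite (bigD1 (- j0)) //= eqxx mulr1 big1 ?addr0 //.
  by move=> k /negPf->; rewrite mulr0.
have size_Q : (size Q <= #|F| ^ n.+1)%N.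
  apply: leq_trans (double_sum_geom_lt q2).
  have -> : (\sum_(k < n.+1) #|F| ^ k + \sum_(k < n.+1) #|F| ^ k =
            \sum_(k < n.+1) (e k + e (k + j0)%R))%N.
    by rewrite big_split /= [X in (_ + X)%N = _](reindex_inj (addIr j0)).
  apply: leq_trans (size_sum _ _ _) _; apply/bigmax_leqP => k _.
  rewrite [X in (_ <= X.+1)%N](bigD1 k) //=.
  apply: leq_trans (size_polyMleq _ _) _.
  have sz_num : (size (num k) <= (e k + e (k + j0)%R).+1)%N.
    apply: leq_trans (size_scale_leq _ _) _.
    apply: leq_trans (size_polyD _ _) _.
    by rewrite size_polyN !size_polyXn geq_max !ltnS leq_addr leq_addl.
  have sz_den j : (size (den j) <= (e j + e (j + j0)%R).+1)%N.
    apply: leq_trans (size_polyD _ _) _; rewrite size_polyN size_poly1.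
    rewrite geq_max /=.
    apply: leq_trans (size_scale_leq _ _) _.
    by rewrite -exprD size_polyXn.
  have := leq_add sz_num (size_prod_le (fun j => j != k) sz_den).
  by rewrite addSn addnS; case: (size _ + size _)%N.
have := max_poly_roots Q_neq0 (introT allP Q_root) Urs.
by rewrite sz_rs ltnNge size_Q.
Qed.

End TraceOfFraction.

(** * Weights as dimensions of fibres *)

Section Fibers.

Variables (F : finFieldType) (L : fieldExtType F).

Lemma linfun_linear (U V : vectType F) (g : U -> V) :
  linear g -> linfun g =1 g.
Proof.
move=> lin_g x; pose h := GRing.isLinear.Build F U V *:%R g lin_g.
by pose gL : {linear U -> V} := HB.pack g h; apply: (lfunE gL).
Qed.

(** The y such that (y, f y) lies on the point (x, f x), up to the isomorphism
    y |-> (y, f y). *)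
Definition fiber (f : {poly L}) (x : L) : {vspace L} :=
  lker (linfun (fun y : L => y * f.[x] - f.[y] * x)).

Lemma mem_fiber f x y :
  linearized f -> (y \in fiber f x) = (y * f.[x] == f.[y] * x).
Proof.
move=> /linearized_linear lin_f; rewrite memv_ker linfun_linear ?subr_eq0 //.
move=> c u v; rewrite lin_f !mulrDl scalerBr !scalerAl.
by rewrite opprD addrACA.
Qed.

Lemma weight_point f x :
  linearized f -> x != 0 -> weight f (point (x, f.[x])) = \dim (fiber f x).
Proof.
move=> lin_f x0; have lin_g : linear (fun y : L => (y, f.[y])).
  by move=> c u v; rewrite (linearized_linear lin_f).
have -> : weight f (point (x, f.[x])) =
    \dim (linfun (fun y => (y, f.[y])) @: fiber f x).
  congr (\dim _); apply/vspaceP=> v; rewrite memv_cap.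
  apply/andP/memv_imgP=> [[/memv_point[a /= va] /(memv_graph _ lin_f)[y vy]]|].
    exists y; last by rewrite linfun_linear.
    rewrite mem_fiber //; move: va; rewrite vy => -[-> ->].
    by rewrite mulrAC.
  case=> y; rewrite mem_fiber // linfun_linear // => /eqP yf ->; split.
    apply/memv_point; exists (y / x) => /=.
    by rewrite divfK // mulrAC yf mulfK.
  by apply/memv_graph => //; exists y.
apply: limg_dim_eq; apply/eqP; rewrite -subv0; apply/subvP=> y.
rewrite memv_cap memv_ker linfun_linear // => /andP[_ /eqP[-> _]].
exact: mem0v.
Qed.

End Fibers.

(** * Roots of unity and Frobenius orbits *)

Section RootsOfUnity.

Variables (F : finFieldType) (L : fieldExtType F).

(** 'X^d - 1 divides 'X^(#|L|) - 'X, the product of the 'X - z for z in L, so it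
    has d distinct roots. *)
Lemma roots_of_unity_seq d :
  (0 < d)%N -> (d %| #|F| ^ \dim {:L} - 1)%N ->
  exists2 Z : seq L, uniq Z & size Z = d /\ forall z, (z \in Z) = (z ^+ d == 1).
Proof.
move=> d0 /dvdnP[k dk]; have [rs Urs [sz_rs _]] := subfield_elements {:L}%AS.
have q0 : (0 < #|F| ^ \dim {:L})%N by rewrite expn_gt0 ltnW ?finNzRing_gt1.
have q1 : (1 < #|F| ^ \dim {:L})%N.
  by rewrite -(exp1n (\dim {:L})) ltn_exp2r ?finNzRing_gt1 // adim_gt0.
have p_dvd : ('X^d - 1 : {poly L}) %| \prod_(z <- rs) ('X - z%:P).
  have sz : size ('X^(#|F| ^ \dim {:L}) - 'X : {poly L}) = (size rs).+1.
    rewrite sz_rs size_polyDl size_polyXn // size_polyN size_polyX.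
    by rewrite ltnS.
  have mon : lead_coef ('X^(#|F| ^ \dim {:L}) - 'X : {poly L}) = 1.
    rewrite lead_coefDl ?lead_coefXn // size_polyXn size_polyN size_polyX.
    by rewrite ltnS.
  rewrite -[X in _ %| X]scale1r -mon -all_roots_prod_XsubC ?uniq_rootsE //.
    rewrite -(subnK q0) addn1 exprS dk mulnC exprM.
    have -> (Y : {poly L}) : 'X * Y - 'X = 'X * (Y - 1) by rewrite mulrBr mulr1.
    by rewrite [X in _ %| _ * X]subrX1 dvdp_mull // dvdp_mulr.
  apply/allP=> z _; rewrite rootE hornerD hornerN hornerXn hornerX.
  by rewrite -/(frob _ z) frob_dimf subrr.
have [b eq_b] := dvdp_prod_XsubC p_dvd.
exists (mask b rs); first exact: mask_uniq.
split=> [|z]; last first.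
  rewrite -root_prod_XsubC -(eqp_root eq_b) rootE hornerD hornerN hornerXn.
  by rewrite hornerC subr_eq0.
have := eqp_size eq_b; rewrite size_prod_XsubC size_XnsubC //.
by case.
Qed.

Lemma frob_inv i k (z : L) :
  frob i z = z^-1 -> frob (i * k) z = if odd k then z^-1 else z.
Proof.
move=> iz; elim: k => [|k IHk]; first by rewrite muln0 frob0.
rewrite mulnS -frob_frob IHk /=; case: (odd k) => //=.
by rewrite fmorphV /= iz invrK.
Qed.

Lemma sum_frob_shift t i (h : L) : frob t h = h ->
  \sum_(k < t) frob k (frob i h) = \sum_(k < t) frob k h.
Proof.
move=> th; elim: i => [|i <-]; first by under eq_bigr do rewrite frob0.
have: frob t (frob i h) = frob i h by rewrite frobC th.
rewrite -addn1 addnC; under eq_bigr do rewrite -(frob_frob 1 i).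
move: (frob i h) => g; case: t {th} => [|t] tg; first by rewrite !big_ord0.
rewrite big_ord_recr big_ord_recl /= frob0 frob_frob addn1 tg addrC.
by congr (_ + _); apply: eq_bigr => k _; rewrite /= frob_frob addn1.
Qed.

End RootsOfUnity.

(** * The quadrinomial in the decomposition of L *)

Section Quadrinomial.

Variables (t J : nat) (F : finFieldType) (L : fieldExtType F).
Variables (Fqt : {subfield L}) (m : L).
Hypotheses (q_odd : odd #|F|) (t_ge3 : (3 <= t)%N).
Hypotheses (dimL : \dim {:L} = (2 * t)%N) (dimK : \dim Fqt = t).
Hypotheses (J_gt0 : (0 < J)%N) (coJt : coprime J (2 * t)).
Hypotheses (mK : m \in Fqt) (m_neq0 : m != 0).

Local Notation q := #|F|.
Local Notation E := (rel_trace_ker t : {pred L}).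
Local Notation s := (@frob F L J).
Local Notation bar := (@frob F L t).
Local Notation s_inv := (@frob F L (J * (2 * t - 1))).
Local Notation f := (phi t m (q ^ J)).

Lemma q_gt2 : (2 < q)%N.
Proof. by have := finNzRing_gt1 F; move: q_odd; case: #|F| => [|[|[|k]]]. Qed.

Lemma two_neq0 : (2 : L) != 0.
Proof.
have [p p_pr pF] := finPcharP F.
have pL : p \in [pchar L] by rewrite pchar_lalg.
rewrite -(dvdn_pcharf pL); apply/negP=> p2.
have p_eq2 : p = 2 by apply/eqP; rewrite -dvdn_prime2.
have := q_odd; have := finNzRing_gt1 F; rewrite (card_pprimeChar pF).
by move: (logn _ _); rewrite p_eq2 => -[|k] // _; rewrite oddX.
Qed.

Lemma J_odd : odd J.
Proof. by move: coJt; rewrite coprimeMr coprimen2 => /andP[]. Qed.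

Lemma frob_2t (x : L) : frob (2 * t) x = x.
Proof. by rewrite -dimL frob_dimf. Qed.

Lemma mem_Fqt x : (x \in Fqt) = (bar x == x).
Proof. by rewrite mem_subfield_frob dimK. Qed.

Lemma bar_bar x : bar (bar x) = x.
Proof. by rewrite frob_frob addnn -mul2n frob_2t. Qed.

Lemma bar_eq_s_t x : bar x = frob (J * t) x.
Proof.
apply: frob_fix_mod (frob_2t x) _.
rewrite -[J in RHS](odd_double_half J) J_odd mulnDl mul1n -mul2n -mulnA.
by rewrite mulnCA -modnDmr modnMl addn0.
Qed.

Lemma s_s_inv x : s (s_inv x) = x.
Proof.
rewrite frob_frob -mulnS subn1 prednK; last by lia.
by apply: frob_fixM (frob_2t x).
Qed.

Lemma s_inv_s x : s_inv (s x) = x.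
Proof. by rewrite frobC s_s_inv. Qed.

Lemma memE x : (x \in E) = (bar x == - x).
Proof. by rewrite inE /rel_trace -addr_eq0. Qed.

(** Eigenvectors of bar for 1 and -1 are independent, as 2 != 0. *)
Lemma split_eq0 x y : bar x = x -> bar y = - y -> x + y = 0 -> x = 0 /\ y = 0.
Proof.
move=> bx by_ xy; have := congr1 bar xy.
rewrite rmorphD rmorph0 /= bx by_ => xy'.
have : 2 * x = 0 by rewrite -(addr0 0) -{1}xy -xy'; ring.
move/eqP; rewrite mulf_eq0 (negPf two_neq0) => /eqP x0.
by move: xy; rewrite x0 add0r.
Qed.

(** Up to the twist by s^-1 and a factor 2, Kpart and Epart are the projections
    onto K and E, the eigenspaces of bar for 1 and -1. The twist is what makes
    the equations of the fibres symmetric in the two parts. *)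
Definition Kpart (x : L) : L := s_inv (x + bar x).
Definition Epart (x : L) : L := x - bar x.
Definition of_parts (a b : L) : L := (s a + b) / 2.

Lemma Kpart_linear : linear Kpart.
Proof.
move=> c x y; rewrite /Kpart -linearP /=; congr (s_inv _).
by rewrite linearP scalerDr addrACA.
Qed.

Lemma Epart_linear : linear Epart.
Proof. by move=> c x y; rewrite /Epart linearP scalerBr opprD addrACA. Qed.

Lemma Kpart0 : Kpart 0 = 0.
Proof. by rewrite /Kpart !rmorph0 addr0 rmorph0. Qed.

Lemma Epart0 : Epart 0 = 0.
Proof. by rewrite /Epart rmorph0 subr0. Qed.

Lemma bar_Kpart x : bar (Kpart x) = Kpart x.
Proof. by rewrite /Kpart frobC rmorphD /= bar_bar addrC. Qed.

Lemma bar_Epart x : bar (Epart x) = - Epart x.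
Proof. by rewrite /Epart rmorphB /= bar_bar opprB. Qed.

Lemma double_split x : 2 * x = s (Kpart x) + Epart x.
Proof. by rewrite /Kpart /Epart s_s_inv; ring. Qed.

Lemma double_inj (x y : L) : 2 * x = 2 * y -> x = y.
Proof. exact: (mulfI two_neq0). Qed.

Lemma parts_inj x y : Kpart x = Kpart y -> Epart x = Epart y -> x = y.
Proof. by move=> e o; apply: double_inj; rewrite !double_split e o. Qed.

Lemma bar_of_parts a b :
  bar a = a -> bar b = - b -> bar (of_parts a b) = (s a - b) / 2.
Proof.
move=> ba bb; rewrite /of_parts fmorph_div rmorphD /= bb frobC ba.
by rewrite rmorph_nat.
Qed.

Lemma Kpart_of a b : bar a = a -> bar b = - b -> Kpart (of_parts a b) = a.
Proof.
move=> ba bb; rewrite /Kpart bar_of_parts // -[RHS]s_inv_s; congr (s_inv _).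
by rewrite /of_parts; move: (s a) two_neq0 => a' n2; field.
Qed.

Lemma Epart_of a b : bar a = a -> bar b = - b -> Epart (of_parts a b) = b.
Proof.
move=> ba bb; rewrite /Epart bar_of_parts //.
by rewrite /of_parts; move: (s a) two_neq0 => a' n2; field.
Qed.

Lemma phiE x : f.[x] = Kpart x + m * s (Epart x).
Proof.
rewrite /phi !(hornerD, hornerZ, hornerN, hornerXn) -!expnM -!/(frob _ x).
rewrite /Kpart /Epart raddfD rmorphB /= !bar_eq_s_t !frob_frob [in RHS]addrC.
rewrite -mulnS addn1 [in RHS]addrC; congr (_ + _).
rewrite [in LHS]addrC -mulnDr; congr (_ + _).
apply: frob_fix_mod (frob_2t x) _.
have -> : (J * (2 * t - 1 + t) = J * (t - 1) + J * (2 * t))%N by nia.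
by rewrite -modnDmr modnMl addn0.
Qed.

Lemma phi_lin : linearized f.
Proof. exact: phi_linearized. Qed.

Definition delta (x y : L) : L := Kpart x * Epart y - Kpart y * Epart x.

Lemma bar_delta x y : bar (delta x y) = - delta x y.
Proof.
have := (bar_Kpart x, bar_Kpart y, bar_Epart x, bar_Epart y).
rewrite /delta.
move: (Kpart x) (Kpart y) (Epart x) (Epart y).
move=> a a' b b' [[[ba ba'] bb] bb'].
by rewrite rmorphB !rmorphM /= ba ba' bb bb'; ring.
Qed.

(** The difference of the two products is the sum of an element fixed by bar and
    of one negated by bar; both have to vanish. *)
Lemma split_collinear a b a' b' :
  bar a = a -> bar a' = a' -> bar b = - b -> bar b' = - b' ->
  (s a' + b') * (a + m * s b) = (a' + m * s b') * (s a + b) <->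
  m * s (a * b' - a' * b) = a * b' - a' * b /\
  a * s a' - a' * s a = m * (b * s b' - b' * s b).
Proof.
move=> ba ba' bb bb'; have bm : bar m = m by apply/eqP; rewrite -mem_Fqt.
have bsa : bar (s a) = s a by rewrite frobC ba.
have bsa' : bar (s a') = s a' by rewrite frobC ba'.
have bsb : bar (s b) = - s b by rewrite frobC bb rmorphN.
have bsb' : bar (s b') = - s b' by rewrite frobC bb' rmorphN.
pose X := a * s a' - a' * s a - m * (b * s b' - b' * s b).
pose Y := a * b' - a' * b - m * (s a * s b' - s a' * s b).
have sD : s (a * b' - a' * b) = s a * s b' - s a' * s b.
  by rewrite rmorphB !rmorphM.
have XY : (s a' + b') * (a + m * s b) - (a' + m * s b') * (s a + b) = X + Y.
  by rewrite /X /Y; ring.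
have bX : bar X = X.
  by rewrite /X !(rmorphB, rmorphM) /= bm bsa bsa' bsb bsb' ba ba' bb bb'; ring.
have bY : bar Y = - Y.
  by rewrite /Y !(rmorphB, rmorphM) /= bm bsa bsa' bsb bsb' ba ba' bb bb'; ring.
rewrite sD; split=> [eq_xy | [Y0 X0]].
  move: XY; rewrite eq_xy subrr => /esym/(split_eq0 bX bY)[/eqP + /eqP].
  by rewrite !subr_eq0 => /eqP-> /eqP<-.
by apply/eqP; rewrite -subr_eq0 XY /X /Y X0 Y0 !subrr addr0.
Qed.

Lemma mem_fiberP x y : reflect
  (m * s (delta x y) = delta x y /\
   Kpart x * s (Kpart y) - Kpart y * s (Kpart x) =
     m * (Epart x * s (Epart y) - Epart y * s (Epart x)))
  (y \in fiber f x).
Proof.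
have xyP := split_collinear (bar_Kpart x) (bar_Kpart y)
                            (bar_Epart x) (bar_Epart y).
rewrite mem_fiber; last exact: phi_lin.
rewrite -(inj_eq double_inj) mulrA [2 * (_ * x)]mulrCA !double_split !phiE.
by apply: (iffP eqP) => /xyP.
Qed.

Lemma parts_neq0 x : x != 0 -> (Kpart x != 0) || (Epart x != 0).
Proof.
move=> x0; rewrite -negb_and; apply: contra x0 => /andP[/eqP e /eqP o].
have /eqP := double_split x; rewrite e o rmorph0 addr0 mulf_eq0.
by rewrite (negPf two_neq0).
Qed.

(** The factor h is a quotient of two elements of K, or of two elements of E. *)
Lemma delta0_proportional x y : x != 0 -> delta x y = 0 ->
  exists h, [/\ bar h = h, Kpart y = h * Kpart x & Epart y = h * Epart x].
Proof.
move=> /parts_neq0 x0 /eqP; rewrite subr_eq0 => /eqP d0.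
case: (eqVneq (Kpart x) 0) x0 => [ex0 /= ox0 | ex0 _].
  exists (Epart y / Epart x); split; last by rewrite divfK.
    by rewrite fmorph_div /= !bar_Epart invrN mulrNN.
  move/eqP: d0; rewrite ex0 mul0r mulr0 eq_sym mulf_eq0 (negPf ox0) orbF.
  by move/eqP.
exists (Kpart y / Kpart x); split.
- by rewrite fmorph_div /= !bar_Kpart.
- by rewrite divfK.
by rewrite mulrAC -d0 mulrAC mulfV // mul1r.
Qed.

(** For degenerate x, all multiples by elements of K of the parts of x give
    elements of the fibre of x: see dim_fiber_degenerate. *)
Definition degenerate x : bool :=
  Kpart x * s (Kpart x) == m * (Epart x * s (Epart x)).

Lemma s_fixed_scalar h : s h = h -> exists c : F, h = c%:A.
Proof.
move=> sh; apply: frob1_scalar.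
exact: frob_fix1 J_gt0 coJt sh (frob_2t h).
Qed.

Lemma fiber_line x y : x != 0 -> ~~ degenerate x ->
  y \in fiber f x -> delta x y = 0 -> y \in <[x]>%VS.
Proof.
move=> x0 ndg /mem_fiberP[_ X0] d0.
have [h [bh ey oy]] := delta0_proportional x0 d0.
have sh : s h = h.
  have: (s h - h) * (Kpart x * s (Kpart x) - m * (Epart x * s (Epart x))) = 0.
    move/eqP: X0; rewrite -subr_eq0 ey oy !rmorphM /= => /eqP; apply: etrans.
    by ring.
  move/eqP; rewrite mulf_eq0 orbC subr_eq0 -/(degenerate x) (negPf ndg) /=.
  by rewrite subr_eq0 => /eqP.
have [c hc] := s_fixed_scalar sh; apply/vlineP; exists c.
apply: double_inj; rewrite double_split ey oy rmorphM /= sh -mulrDr.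
by rewrite -double_split hc mulrCA -scalerAl mul1r.
Qed.

Lemma mem_fiber_self x : x \in fiber f x.
Proof. by apply/mem_fiberP; rewrite /delta !subrr rmorph0 mulr0. Qed.

Lemma line_fiber x : (<[x]> <= fiber f x)%VS.
Proof. by rewrite -memvE mem_fiber_self. Qed.

Lemma sigma_pred_power e : e != 0 -> m = e ^+ (q ^ J - 1) <-> s e = m * e.
Proof.
move=> e0; have -> : s e = e ^+ (q ^ J - 1) * e.
  by rewrite -exprSr subn1 prednK // expn_gt0 (ltn_trans _ q_gt2).
by split=> [<- // | /(mulIf e0)->].
Qed.

Lemma sigma_succ_power e : e ^+ (q ^ J + 1) = e * s e.
Proof. by rewrite addn1 exprS. Qed.

Lemma power_neq0 e k : (0 < k)%N -> m = e ^+ k -> e != 0.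
Proof. by move=> k0 me; move: m_neq0; rewrite me expf_eq0 k0. Qed.

(** Let P be the product of the s^i d for i < t. As m = d s(d), iterating
    m s(w) = w over t steps gives bar(w) P s(P) = w, while s(P) = P bar(d) / d
    = - P. Hence P^2 = 1, so P = 1 or P = -1 is fixed by s, which contradicts
    s(P) = - P. *)
Lemma powers_exclusive w d : bar w = - w -> bar d = - d -> w != 0 ->
  m * s w = w -> d * s d <> m.
Proof.
move=> bw bd w0 sw sd.
have d0 : d != 0 by apply: contraNneq m_neq0 => d0; rewrite -sd d0 mul0r.
pose P k := \prod_(i < k) frob (J * i) d.
have PS k : P k.+1 = P k * frob (J * k) d by rewrite /P big_ord_recr.
have sP k : s (P k) * d = P k * frob (J * k) d.
  rewrite -PS /P big_ord_recl muln0 frob0 rmorph_prod mulrC; congr (_ * _).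
  by apply: eq_bigr => i _; rewrite /= frob_frob -mulnS.
have frob_w k : frob (J * k) w * (P k * s (P k)) = w.
  elim: k => [|k IHk].
    by rewrite muln0 frob0 /P big_ord0 rmorph1 !mulr1.
  rewrite -[RHS]IHk -{2}sw -sd PS mulnSr -frob_frob !rmorphM /=.
  by rewrite (frobC J); ring.
have sPt : s (P t) = - P t.
  by apply: (mulIf d0); rewrite sP -bar_eq_s_t bd mulrN mulNr.
have Pt2 : P t ^+ 2 = 1.
  have := frob_w t; rewrite -bar_eq_s_t bw sPt mulrN mulrNN -expr2.
  by rewrite -{2}[w]mulr1 => /(mulfI w0).
have P0 : P t != 0.
  by apply/eqP=> P0; move/eqP: Pt2; rewrite P0 expr0n eq_sym oner_eq0.
have sPt' : s (P t) = P t.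
  move/eqP: Pt2; rewrite -subr_eq0 subr_sqr_1 mulf_eq0 subr_eq0 addr_eq0.
  by case/orP=> /eqP->; rewrite ?rmorphN rmorph1.
move/eqP: sPt; rewrite sPt' -addr_eq0 -mulr2n -mulr_natl.
by rewrite mulf_eq0 (negPf two_neq0) (negPf P0).
Qed.



(** * Weights when m is not a (sigma - 1)-power *)

(** s(D) / D = 1 / m amounts to s(1 / D) / (1 / D) = m. *)
Lemma anti_eigen_power D :
  bar D = - D -> D != 0 -> m * s D = D -> is_power_of E (q ^ J - 1) m.
Proof.
move=> bD D0 sD; exists D^-1; first by rewrite memE fmorphV /= bD invrN.
apply/sigma_pred_power; rewrite ?invr_eq0 //.
rewrite fmorphV /= -{2}sD invfM mulrA mulfV // mul1r.
exact: erefl.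
Qed.

Lemma delta_eq0 x y :
  ~ is_power_of E (q ^ J - 1) m -> y \in fiber f x -> delta x y = 0.
Proof.
move=> npow /mem_fiberP[sD _]; have [//|D0] := eqVneq (delta x y) 0.
by case: npow; apply: anti_eigen_power (bar_delta x y) D0 sD.
Qed.

Lemma of_parts_linear c a b a' b' :
  of_parts (c *: a + a') (c *: b + b') = c *: of_parts a b + of_parts a' b'.
Proof.
rewrite /of_parts linearP /= scalerAl -mulrDl; congr (_ / _).
by rewrite scalerDr addrACA.
Qed.

Lemma degenerate_Epart_neq0 x : x != 0 -> degenerate x -> Epart x != 0.
Proof.
move=> /parts_neq0 x0 dg; apply: contraTneq dg => ox0.
rewrite /degenerate ox0 mul0r mulr0 mulf_eq0 [s _ == 0]fmorph_eq0 orbb.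
by move: x0; rewrite ox0 eqxx orbF.
Qed.

(** With a and b the parts of x, h |-> of_parts (h a) (h b) is an isomorphism
    from K to the fibre. *)
Lemma dim_fiber_degenerate x :
  ~ is_power_of E (q ^ J - 1) m -> x != 0 -> degenerate x ->
  \dim (fiber f x) = t.
Proof.
move=> npow x0 dg; have ox0 := degenerate_Epart_neq0 x0 dg.
pose g h := of_parts (h * Kpart x) (h * Epart x).
have lin_g : linear g.
  by move=> c h k; rewrite /g -of_parts_linear !mulrDl !scalerAl.
have bh h : h \in Fqt ->
    bar (h * Kpart x) = h * Kpart x /\ bar (h * Epart x) = - (h * Epart x).
  rewrite mem_Fqt => /eqP bh; rewrite !rmorphM /= bh bar_Kpart bar_Epart.
  by rewrite mulrN.
have -> : fiber f x = (linfun g @: Fqt)%VS.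
  apply/vspaceP=> y; apply/idP/memv_imgP=> [yx | [h hK ->]].
    have [h [bh' ey oy]] := delta0_proportional x0 (delta_eq0 npow yx).
    have hK : h \in Fqt by rewrite mem_Fqt bh'.
    have [be bo] := bh h hK.
    exists h => //; rewrite linfun_linear //.
    by apply: parts_inj; rewrite ?Kpart_of ?Epart_of.
  have [be bo] := bh h hK; rewrite linfun_linear //.
  apply/mem_fiberP; rewrite /delta Kpart_of // Epart_of //; split.
    have -> : Kpart x * (h * Epart x) - h * Kpart x * Epart x = 0 by ring.
    by rewrite rmorph0 mulr0.
  rewrite !rmorphM /=; move/eqP: dg => dg.
  have -> : Kpart x * (s h * s (Kpart x)) - h * Kpart x * s (Kpart x) =
            (s h - h) * (Kpart x * s (Kpart x)) by ring.
  by rewrite dg; ring.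
rewrite limg_dim_eq ?dimK //; apply/eqP; rewrite -subv0; apply/subvP=> h.
rewrite memv_cap memv_ker linfun_linear // => /andP[/bh[be bo] /eqP gh].
have := Epart_of be bo; rewrite -/(g h) gh Epart0.
by move/esym/eqP; rewrite mulf_eq0 (negPf ox0) orbF memv0.
Qed.

Lemma dim_fiber_nondegenerate x :
  ~ is_power_of E (q ^ J - 1) m -> x != 0 -> ~~ degenerate x ->
  \dim (fiber f x) = 1%N.
Proof.
move=> npow x0 ndg.
have -> : fiber f x = <[x]>%VS; last by rewrite dim_vline x0.
apply/eqP; rewrite eqEsubv line_fiber andbT; apply/subvP=> y yx.
exact: fiber_line x0 ndg yx (delta_eq0 npow yx).
Qed.

Lemma weight_of_point x : ~ is_power_of E (q ^ J - 1) m -> x != 0 ->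
  weight f (point (x, f.[x])) = if degenerate x then t else 1%N.
Proof.
move=> npow x0; rewrite (weight_point phi_lin x0); case: ifPn => dg.
  exact: dim_fiber_degenerate.
exact: dim_fiber_nondegenerate.
Qed.

Lemma point_slope (x c : L) : x != 0 -> point (x, c * x) = point (1, c).
Proof.
move=> x0; apply/vspaceP=> v.
apply/memv_point/memv_point=> -[a /= ->].
  by exists (a * x); congr (_, _) => /=; ring.
by exists (a / x); congr (_, _) => /=; field.
Qed.

Lemma point_slope_inj (c c' : L) : point (1, c) = point (1, c') -> c = c'.
Proof.
move=> eqP; have: (1, c) \in point (1, c).
  by apply/memv_point; exists 1; rewrite /= !mul1r.
by rewrite eqP => /memv_point[a /= [a1 ->]]; rewrite -[a]mulr1 -a1 mul1r.
Qed.

(** For r = a / b, where a and b are the parts of x, the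
    identity m = r s(r) gives f(x) = r b + r s(r b) = r (b + s a) = 2 r x. *)
Lemma degenerate_slope x : x != 0 -> degenerate x ->
  exists r, [/\ bar r = - r, r * s r = m & point (x, f.[x]) = point (1, 2 * r)].
Proof.
move=> x0 dg; have ox0 := degenerate_Epart_neq0 x0 dg.
have sox0 : s (Epart x) != 0 by rewrite fmorph_eq0.
exists (Kpart x / Epart x); 
have rm : Kpart x / Epart x * s (Kpart x / Epart x) = m.
  rewrite fmorph_div /= mulf_div (eqP dg) mulfK //.
  by rewrite mulf_neq0.
split=> //; first by rewrite fmorph_div /= bar_Kpart bar_Epart invrN mulrN.
rewrite -(point_slope _ x0); congr (point (_, _)).
move: rm; set r := Kpart x / Epart x => rm.
have er : Kpart x = r * Epart x by rewrite divfK.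
have ser : s (Kpart x) = s r * s (Epart x) by rewrite er rmorphM.
by rewrite phiE -{1}rm [2 * r]mulrC -[RHS]mulrA double_split ser {1}er; ring.
Qed.

(** Take the parts r^2 and r, whose quotient is r. *)
Lemma slope_degenerate r : bar r = - r -> r * s r = m ->
  exists x, [/\ x != 0, degenerate x & point (x, f.[x]) = point (1, 2 * r)].
Proof.
move=> br rm; have r0 : r != 0.
  by apply: contraNneq m_neq0 => r0; rewrite -rm r0 mul0r.
have br2 : bar (r * r) = r * r by rewrite rmorphM /= br mulrNN.
pose x := of_parts (r * r) r; have ex : Kpart x = r * r by apply: Kpart_of.
have ox : Epart x = r by apply: Epart_of.
have x0 : x != 0.
  by apply: contraNneq r0 => x0; rewrite -ox x0 Epart0.
exists x; split=> //.
  by rewrite /degenerate ex ox -rm rmorphM /=; apply/eqP; ring.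
rewrite -(point_slope _ x0); congr (point (_, _)).
by rewrite mulrAC mulrC double_split phiE ex ox -rm rmorphM /=; ring.
Qed.

Lemma count_degenerate (S : seq L) :
  ~ is_power_of E (q ^ J - 1) m -> uniq S ->
  (forall r, r \in S <-> bar r = - r /\ r * s r = m) ->
  count (fun P => weight f P == t) (linear_set f) = size S.
Proof.
move=> npow US SP; have t1 : (t == 1%N) = false.
  by apply: gtn_eqF; apply: ltn_trans t_ge3.
rewrite -size_filter -(size_map (fun r : L => point (1, 2 * r))).
apply: perm_size; apply: uniq_perm; first by rewrite filter_uniq ?undup_uniq.
  by rewrite map_inj_uniq // => r r' /point_slope_inj/double_inj.
move=> P; rewrite mem_filter; apply/andP/mapP=> [[] | [r /SP[br rm] ->]].
  move=> wP /mem_linear_set[x x0 PE]; move: wP; rewrite PE weight_of_point //.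
  case: ifPn => [dg _ | _]; last by rewrite eq_sym t1.
  by have [r [br rm ->]] := degenerate_slope x0 dg; exists r => //; apply/SP.
have [x [x0 dg <-]] := slope_degenerate br rm.
split; first by rewrite weight_of_point // dg.
by apply/mem_linear_set; exists x.
Qed.

Lemma scattered_case :
  ~ is_power_of E (q ^ J - 1) m -> ~ is_power_of E (q ^ J + 1) m -> scattered f.
Proof.
move=> npow npow' P /mem_linear_set[x x0 ->]; rewrite weight_of_point //.
case: ifPn => // dg; have [r [br rm _]] := degenerate_slope x0 dg.
by case: npow'; exists r; rewrite ?memE ?br // sigma_succ_power.
Qed.

Lemma regular_fat_case (S : seq L) :
  ~ is_power_of E (q ^ J - 1) m -> uniq S ->
  (forall r, r \in S <-> bar r = - r /\ r * s r = m) ->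
  regular_fat (size S) t f.
Proof.
move=> npow US SP; split; first exact: ltnW.
- exact: count_degenerate.
- move=> P /mem_linear_set[x x0 ->]; rewrite weight_of_point //.
  by case: ifP; rewrite ?eqxx.
(* A nonzero element of K has E-part 0, hence is not degenerate. *)
have b1 : bar 1 = 1 by rewrite rmorph1.
have b0 : bar 0 = - 0 by rewrite rmorph0 oppr0.
pose x := of_parts 1 0; have ex : Kpart x = 1 by apply: Kpart_of.
have ox : Epart x = 0 by apply: Epart_of.
have x0 : x != 0.
  by apply: contra_eq_neq ex => ->; rewrite Kpart0 eq_sym oner_neq0.
exists (point (x, f.[x])); first by apply/mem_linear_set; exists x.
rewrite weight_of_point // /degenerate ex ox mul0r mulr0 rmorph1 mulr1.
by rewrite oner_eq0.
Qed.



(** * Counting the degenerate points *)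

(** If z s(z) = 1, an odd power of s inverts z and an even one fixes it. If t is
    odd, this applies to bar, which fixes z, so that z^2 = 1. If t is even, it
    applies to the Frobenius, which is an odd power of s since J is odd: hence
    z^(q + 1) = 1. Conversely such a z is inverted by s, an odd power of the
    Frobenius, and fixed by bar, an even one. *)
Lemma unit_norm_seq : exists2 Z : seq L, uniq Z &
  size Z = (if odd t then 2 else q + 1)%N /\
  forall z, z \in Z <-> bar z = z /\ z * s z = 1.
Proof.
have sz_inv z : z * s z = 1 -> s z = z^-1.
  move=> zs; have z0 : z != 0.
    by apply: contra_eq_neq zs => ->; rewrite mul0r eq_sym oner_eq0.
  by apply: (mulfI z0); rewrite zs mulfV.
case: ifPn => [t_odd | t_even].
  exists [:: 1; -1].
    rewrite /= inE andbT -addr_eq0.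
    exact: two_neq0.
  split=> // z; rewrite !inE; split=> [/orP[] /eqP-> | [bz zs]].
  - by rewrite !rmorph1 mulr1.
  - by rewrite !rmorphN !rmorph1 mulrNN mulr1.
  move: bz; rewrite bar_eq_s_t (frob_inv _ (sz_inv z zs)) t_odd => zV.
  have /eqP : z * z = 1 by rewrite -zs (sz_inv z zs) zV.
  by rewrite -expr2 -subr_eq0 subr_sqr_1 mulf_eq0 subr_eq0 addr_eq0.
have dvd : (q.+1 %| q ^ \dim {:L} - 1)%N.
  rewrite dimL expnM -{2}(exp1n t) subn_exp dvdn_mulr //.
  by rewrite -{2}(exp1n 2) subn_sqr addn1 dvdn_mull.
have [Z UZ [szZ ZP]] := roots_of_unity_seq (ltn0Sn q) dvd.
exists Z => //; split=> [|z]; first by rewrite szZ addn1.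
rewrite ZP exprS; split=> [/eqP zq | [bz zs]].
  have z0 : z != 0.
    by apply: contra_eq_neq zq => ->; rewrite mul0r eq_sym oner_eq0.
  have f1z : frob 1 z = z^-1 by apply: (mulfI z0); rewrite /frob expn1 zq mulfV.
  have := (frob_inv t f1z, frob_inv J f1z).
  by rewrite !mul1n (negPf t_even) J_odd => -[-> ->]; rewrite mulfV.
have [k kJ] := modular_inverse J_gt0 coJt.
have k_odd : odd k.
  have even_2t : odd (2 * t) = false by rewrite oddM.
  have : odd (k * J) by rewrite -(odd_mod _ even_2t) kJ odd_mod.
  by rewrite oddM J_odd andbT.
have := frob_fix_mod (frob_2t z) kJ.
rewrite mulnC (frob_inv _ (sz_inv z zs)) k_odd /frob expn1 => <-.
by rewrite -zs (sz_inv z zs).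
Qed.

(** The r in E with r s(r) = m are the z d for the z of unit_norm_seq. *)
Lemma sigma_succ_case d :
  d \in E -> d * s d = m -> ~ is_power_of E (q ^ J - 1) m ->
  regular_fat (if odd t then 2 else q + 1)%N t f.
Proof.
rewrite memE => /eqP bd sd npow; have [Z UZ [szZ ZP]] := unit_norm_seq.
have d0 : d != 0 by apply: contraNneq m_neq0 => d0; rewrite -sd d0 mul0r.
have sd0 : s d != 0 by rewrite fmorph_eq0.
rewrite -szZ -(size_map (fun z => z * d)); apply: regular_fat_case => //.
  by rewrite map_inj_uniq //; apply: mulIf.
move=> r; split=> [/mapP[z /ZP[bz zs] ->] | [br rm]].
  rewrite !rmorphM /= bz bd mulrN; split=> //.
  by rewrite mulrACA zs mul1r.
apply/mapP; exists (r / d); last by rewrite divfK.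
apply/ZP; rewrite !fmorph_div /= br bd invrN mulrNN; split=> //.
by rewrite mulf_div rm sd mulfV.
Qed.

(** * Weights when m is a (sigma - 1)-power *)

Section SigmaPredPower.

Variable w : L.
Hypotheses (bar_w : bar w = - w) (w_neq0 : w != 0) (m_s_w : m * s w = w).

Lemma never_degenerate x : x != 0 -> ~~ degenerate x.
Proof.
move=> x0; apply/negP=> /(degenerate_slope x0)[r [br rm _]].
exact: (powers_exclusive bar_w br w_neq0 m_s_w rm).
Qed.

(** y |-> delta x y maps the fibre to the line of w, with kernel the line of
    x. *)
Lemma dim_fiber_le2 x : x != 0 -> (\dim (fiber f x) <= 2)%N.
Proof.
move=> x0; have lin_d : linear (delta x).
  move=> c y z; rewrite /delta Kpart_linear Epart_linear mulrDr mulrDl.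
  by rewrite -scalerAr -scalerAl scalerBr opprD addrACA.
have dim_line (z : L) : (\dim <[z]> <= 1)%N by rewrite dim_vline leq_b1.
rewrite -(limg_ker_dim (linfun (delta x))); apply: (@leq_add _ _ 1 1).
  apply: leq_trans (dimvS _) (dim_line x); apply/subvP=> y.
  rewrite memv_cap memv_ker linfun_linear //.
  by case/andP=> yx /eqP; apply: fiber_line x0 (never_degenerate x0) yx.
apply: leq_trans (dimvS _) (dim_line w).
apply/subvP=> D /memv_imgP[y /mem_fiberP[sD _]].
rewrite linfun_linear // => ->; have w0 := w_neq0.
have sw0 : s w != 0 by rewrite fmorph_eq0.
have [c cD] : exists c : F, delta x y / w = c%:A.
  apply: s_fixed_scalar; rewrite fmorph_div /=.
  by rewrite -[in RHS]sD -[in RHS]m_s_w -mulf_div mulfV // mul1r.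
by apply/vlineP; exists c; rewrite -[c *: w]mulr_algl -cD divfK.
Qed.

(** As delta x y = g w, the E-part of y is (g / A + h u / A) w. Dividing the
    second equation of the fibre by A s(A) then leaves an equation for h
    alone. *)
Lemma fiber_difference_equation A u x y :
  A != 0 -> Kpart x = A -> Epart x = u / A * w -> y \in fiber f x ->
  let h := Kpart y / A in let g := delta x y / w in
  let D := (w / (A * s A)) ^+ 2 in
  s g = g /\ (s h - h) * (1 - D * (u * s u)) = g * (D * (u - s u)).
Proof.
move=> A0 ex ox /mem_fiberP[sd X0] h g D.
have w0 := w_neq0; have sw0 : s w != 0 by rewrite fmorph_eq0.
have sA0 : s A != 0 by rewrite fmorph_eq0.
have sg : s g = g.
  rewrite /g fmorph_div /= -[in RHS]sd -[in RHS]m_s_w -mulf_div mulfV //.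
  by rewrite mul1r.
split=> //; have mE : m = w / s w by rewrite -{1}m_s_w mulfK.
have oy : Epart y = (g * w + Kpart y * (u / A * w)) / A.
  by rewrite /g divfK // /delta ex ox addrNK mulrC mulKf.
clearbody g.
have sox : s (Epart x) = s u / s A * s w by rewrite ox rmorphM fmorph_div.
have soy : s (Epart y) = (g * s w + s (Kpart y) * (s u / s A * s w)) / s A.
  by rewrite oy fmorph_div rmorphD !rmorphM fmorphV /= sg.
have sh : s h = s (Kpart y) / s A by rewrite fmorph_div.
move/eqP: X0; rewrite -subr_eq0 ex sox soy ox oy mE => /eqP X0.
apply/eqP; rewrite -subr_eq0 -(mul0r (A * s A)^-1) -X0 sh /h /D; apply/eqP.
move: (Kpart y) (s (Kpart y)) (s A) (s u) (s w) sA0 sw0.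
move=> a' sa' sA su sw sA0 sw0.
by field; rewrite A0 sA0 sw0.
Qed.

(** Otherwise A = 1 gives s(w^2) = w^2, and then s^2(A)^2 = A^2 for all A in K;
    comparing this for A and A + 1 yields s^2(A) = A, so A^(q^2) = A. But K has
    more than q^2 elements. *)
Lemma exists_unstable_multiplier : exists A,
  [/\ A \in Fqt, A != 0 & s ((w / (A * s A)) ^+ 2) != (w / (A * s A)) ^+ 2].
Proof.
have [rs Urs [sz_rs rsK]] := subfield_elements Fqt; rewrite dimK in sz_rs.
pose P A := (A != 0) && (s ((w / (A * s A)) ^+ 2) != (w / (A * s A)) ^+ 2).
have [/hasP[A] | /hasPn allz] := boolP (has P rs).
  by rewrite rsK => AK /andP[A0 PA]; exists A.
have stable A : A \in Fqt -> A != 0 ->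
    s ((w / (A * s A)) ^+ 2) = (w / (A * s A)) ^+ 2.
  by rewrite -rsK => /allz; rewrite negb_and negbK => /orP[-> // | /negPn/eqP].
have sw2 : (s w) ^+ 2 = w ^+ 2.
  have := stable 1 (mem1v _) (oner_neq0 _).
  by rewrite rmorph1 mulr1 divr1 rmorphXn.
have ss_sqr A : A \in Fqt -> s (s A) ^+ 2 = A ^+ 2.
  have [-> _ | A0 AK] := eqVneq A 0; first by rewrite !rmorph0.
  have sA0 : s A != 0 by rewrite fmorph_eq0.
  have ssA0 : s (s A) != 0 by rewrite fmorph_eq0.
  have := stable A AK A0.
  rewrite rmorphXn fmorph_div rmorphM /= !expr_div_n sw2.
  have w2 : w ^+ 2 != 0 by rewrite expf_neq0.
  move/(mulfI w2)/invr_inj; rewrite !exprMn mulrC => /mulIf; apply.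
  by rewrite expf_neq0.
have ss_fix A : A \in Fqt -> s (s A) = A.
  move=> AK; have := ss_sqr (A + 1) (rpredD AK (mem1v _)).
  rewrite !rmorphD !rmorph1 /= !sqrrD1 ss_sqr // => /addIr/addrI ssA.
  by apply: double_inj; rewrite !mulr_natl.
have [k kJ] := modular_inverse J_gt0 coJt.
have frob2 A : A \in rs -> frob 2 A = A.
  rewrite rsK => /ss_fix ssA; have kJ2 : (k * (J + J) = 2 %[mod 2 * t])%N.
    by rewrite mulnDr -modnDm kJ modnDm.
  by rewrite -(frob_fix_mod (frob_2t A) kJ2) frob_fixM // -frob_frob.
have := card_fixed_frob Urs (isT : 0 < 2)%N frob2.
by rewrite sz_rs leq_exp2l ?(ltnW q_gt2) // leqNgt t_ge3.
Qed.

(** Choose u such that the fraction of exists_trace_fraction_neq0 has nonzero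
    trace. A y in the fibre with delta x y = g w and g != 0 would make this
    fraction equal to s(h / g) - h / g, whose trace is 0. *)
Lemma exists_fiber_line : exists2 x, x != 0 & fiber f x = <[x]>%VS.
Proof.
have [A [AK A0 sD]] := exists_unstable_multiplier.
set D := (w / (A * s A)) ^+ 2 in sD.
have sw0 : s w != 0 by rewrite fmorph_eq0.
have mE : m = w / s w by rewrite -{1}m_s_w mulfK.
have sA0 : s A != 0 by rewrite fmorph_eq0.
have bA : bar A = A by apply/eqP; rewrite -mem_Fqt.
have bu u : u \in Fqt -> bar u = u by rewrite mem_Fqt => /eqP.
pose x u := of_parts A (u / A * w).
have ex u : u \in Fqt -> Kpart (x u) = A.
  move=> /bu u_; apply: Kpart_of => //.
  by rewrite rmorphM fmorph_div /= u_ bA bar_w mulrN.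
have ox u : u \in Fqt -> Epart (x u) = u / A * w.
  move=> /bu u_; apply: Epart_of => //.
  by rewrite rmorphM fmorph_div /= u_ bA bar_w mulrN.
have x0 u : u \in Fqt -> x u != 0.
  by move=> /ex xA; apply: contra_neq A0 => x_u; rewrite -xA x_u Kpart0.
have den_neq0 u : u \in Fqt -> 1 - D * (u * s u) != 0.
  move=> uK; have := never_degenerate (x0 u uK).
  rewrite /degenerate ex // ox // -subr_eq0; apply: contra => /eqP den0.
  rewrite !rmorphM fmorphV /=; apply/eqP.
  rewrite mE -(mulr0 (A * s A)) -den0 /D.
  by move: (s A) (s u) (s w) sA0 sw0 => sA su sw sA0 sw0; field; rewrite A0 sA0.
have DK : D \in Fqt.
  rewrite mem_Fqt rmorphXn fmorph_div rmorphM /= bar_w frobC bA mulNr.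
  by rewrite sqrrN.
have t_gt0 : (0 < t)%N by apply: ltn_trans t_ge3.
have dimK' : \dim Fqt = t.-1.+1 by rewrite prednK.
have [u uK] := exists_trace_fraction_neq0 dimK' q_gt2 DK sD den_neq0.
rewrite prednK // => nz_trace; exists (x u); first exact: x0.
apply/eqP; rewrite eqEsubv line_fiber andbT; apply/subvP=> y yx.
have [d0 | d0] := eqVneq (delta (x u) y) 0.
  exact: fiber_line (x0 u uK) (never_degenerate (x0 u uK)) yx d0.
have [] := fiber_difference_equation A0 (ex u uK) (ox u uK) yx.
set h := Kpart y / A; set g := delta (x u) y / w; rewrite -/D => sg diff_h.
have g0 : g != 0 by rewrite mulf_neq0 ?invr_eq0.
have bhg : bar (h / g) = h / g.
  rewrite !fmorph_div /= bar_Kpart bA bar_delta bar_w.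
  by rewrite invrN mulrNN.
case/eqP: nz_trace; apply: etrans (subrr (\sum_(k < t) frob k (h / g))).
rewrite -{1}(sum_frob_shift J bhg) -sumrB; apply: eq_bigr => k _.
rewrite -rmorphB /=; congr (frob k _).
rewrite fmorph_div /= sg -mulrBl; apply: (mulIf (den_neq0 u uK)).
rewrite divfK ?den_neq0 //; apply: esym.
by rewrite mulrAC diff_h [g * _]mulrC mulfK.
Qed.

Lemma sigma_pred_case : exists r, regular_fat r 2 f.
Proof.
exists (count (fun P => weight f P == 2) (linear_set f)); split=> //.
  move=> P /mem_linear_set[x x0 ->]; rewrite (weight_point phi_lin x0).
  have := dimvS (line_fiber x); rewrite dim_vline x0 /=.
  by have := dim_fiber_le2 x0; case: (\dim _) => [|[|[|k]]].
have [x x0 fx] := exists_fiber_line; exists (point (x, f.[x])).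
  by apply/mem_linear_set; exists x.
by rewrite (weight_point phi_lin x0) fx dim_vline x0.
Qed.

End SigmaPredPower.

End Quadrinomial.

(** * The theorem *)

Theorem theorem4p9 (q t J sigma : nat) (F : finFieldType) (L : fieldExtType F)
    (Fqt : {subfield L}) (m : L)
    (hq : #|F| = q) (q_odd : odd q) (ht : (3 <= t)%N)
    (hL : \dim {:L} = (2 * t)%N) (hFqt : \dim Fqt = t)
    (hJ : (1 <= J <= 2 * t - 1)%N) (hJt : coprime J (2 * t))
    (hsigma : sigma = (q ^ J)%N)
    (hm : m \in Fqt) (hm0 : m != 0) :
  let E : {pred L} := rel_trace_ker t in
  [/\ is_power_of E (sigma - 1) m ->
        exists r : nat, regular_fat r 2 (phi t m sigma),
      is_power_of E (sigma + 1) m -> odd t ->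
        regular_fat 2 t (phi t m sigma),
      is_power_of E (sigma + 1) m -> ~~ odd t ->
        regular_fat (q + 1) t (phi t m sigma)
    & ~ is_power_of E (sigma - 1) m -> ~ is_power_of E (sigma + 1) m ->
        scattered (phi t m sigma)].
Proof.
move=> E; rewrite {}hsigma; move: q_odd; rewrite -{}hq => q_odd'.
have [J_gt0 _] := andP hJ.
have q0 : (0 < #|F|)%N by apply: ltnW (finNzRing_gt1 F).
have pred_gt0 : (0 < #|F| ^ J - 1)%N.
  by rewrite subn_gt0 -(exp1n J) ltn_exp2r ?finNzRing_gt1.
have twist : is_power_of E (#|F| ^ J - 1) m ->
    exists w, [/\ frob t w = - w, w != 0 & m * frob J w = w].
  case=> e; rewrite memE => /eqP be me; have e0 := power_neq0 hm0 pred_gt0 me.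
  have se : frob J e = m * e by apply/sigma_pred_power.
  exists e^-1; rewrite !fmorphV /= be se invrN invr_eq0; split=> //.
  by rewrite invfM mulrA mulfV // mul1r.
have succ_case : is_power_of E (#|F| ^ J + 1) m ->
    regular_fat (if odd t then 2 else #|F| + 1)%N t (phi t m (#|F| ^ J)).
  case=> d dE; rewrite sigma_succ_power => dm.
  apply: (sigma_succ_case q_odd' ht hL hFqt J_gt0 hJt hm hm0 dE (esym dm)).
  move=> /twist[w [bw w0 mw]]; move: dE; rewrite memE => /eqP bd.
  exact: (powers_exclusive q_odd' hL hJt hm0 bw bd w0 mw (esym dm)).
split.
- move=> /twist[w [bw w0 mw]].
  exact: (sigma_pred_case q_odd' ht hL hFqt J_gt0 hJt hm hm0 bw w0 mw).
- by move=> /succ_case + t_odd; rewrite t_odd.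
- by move=> /succ_case + /negPf t_even; rewrite t_even.
exact: (scattered_case q_odd' ht hL hFqt J_gt0 hJt hm).
Qed.
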